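(* Let $n \ge 1$ be an integer, let $j = 4$ with $j \le 2n$, and let $N = n^2 + j = n^2+4$. If $n$ is even, then the length of the period of the continued fraction of $\sqrt{N}$ is $2$ and $\sqrt{N} = [n, \overline{\tfrac{2n}{j}, 2n}]$. If $n$ is odd, then the length of the period is $5$ and $\sqrt{N} = [n, \overline{\tfrac{n-1}{2}, 1, 1, \tfrac{n-1}{2}, 2n}]$.
   Context: The (simple) continued fraction expansion of an irrational real number $x$ is the unique infinite sequence $[a_0,a_1,a_2,\dots]$ with $a_0\in\mathbb Z$ and $a_i$ a positive integer for $i\ge 1$, such that the convergents $a_0+\cfrac{1}{a_1+\cfrac{1}{\ddots+\cfrac{1}{a_m}}}$ converge to $x$ as $m\to\infty$. The notation $[a_0,\dots,a_k,\overline{a_{k+1},\dots,a_\ell}]$ means that the block $a_{k+1},\dots,a_\ell$ is repeated infinitely many times after the preperiod $a_0,\dots,a_k$. The length of the period is the number of entries in the shortest repeating block. *)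

(* Defs.v *)
From Stdlib Require Import Reals QArith Qreals ZArith List.
From Coquelicot Require Import Coquelicot.

Definition irrational (x : R) : Prop := ~ exists q : Q, x = Q2R q.

(* a_0 + 1/(a_1 + 1/(... + 1/a_m)), by recursion on the shifted sequence. *)
Fixpoint convergent (a : nat -> Z) (m : nat) {struct m} : R :=
  match m with
  | O => IZR (a O)
  | S m' => (IZR (a O) + 1 / convergent (fun i => a (S i)) m')%R
  end.

Definition cf_converges (x : R) (a : nat -> Z) : Prop :=
  (forall i : nat, (1 <= i)%nat -> (0 < a i)%Z) /\
  is_lim_seq (convergent a) (Finite x).

(* Existence and uniqueness of the expansion are part of the predicate, so
   that at most one [a] satisfies it for a given [x]. *)
Definition cf_expansion (x : R) (a : nat -> Z) : Prop :=
  irrational x /\ unique (cf_converges x) a.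

(* The sequence pre, block, block, block, ...; meaningful for block <> nil. *)
Definition periodic_seq (pre block : list Z) (i : nat) : Z :=
  if Nat.ltb i (length pre) then nth i pre 0%Z
  else nth (Nat.modulo (i - length pre) (length block)) block 0%Z.

Definition has_repeating_block (a : nat -> Z) (l : nat) : Prop :=
  exists pre block : list Z,
    block <> nil /\ length block = l /\
    forall i : nat, a i = periodic_seq pre block i.

Definition cf_period_length (x : R) (l : nat) : Prop :=
  exists a : nat -> Z,
    cf_expansion x a /\
    has_repeating_block a l /\
    (forall l' : nat, has_repeating_block a l' -> (l <= l')%nat).

(* Main.v *)
Require Import Defs.
From Stdlib Require Import Reals ZArith List.
From Stdlib Require Import QArith Qreals Lia Lra FunctionalExtensionality.
From Coquelicot Require Import Coquelicot.
Set Bullet Behavior "Strict Subproofs".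
Import ListNotations.

(** With [s = sqrt (n^2 + 4)], the complete quotients of [s] are explicit:
    [(s+n)/4, s+n] repeated for even [n], and
    [(s+n)/4, (s+n-2)/n, (s+2)/n, (s+n-2)/4, s+n] repeated for odd [n].
    A sequence of positive complete quotients forces convergence, because two
    successive steps contract the error by a factor at least 4. Partial
    quotients of an irrational number are forced to be the successive integer
    parts, hence unique. The period cannot be shorter because the entry [2n]
    occurs only once in the block. *)

Open Scope R_scope.

(** * Irrationality, and its stability under one continued fraction step *)

Lemma sqrt_between_squares_irrational (n N : Z) :
  (0 <= n)%Z -> (n ^ 2 < N < (n + 1) ^ 2)%Z -> irrational (sqrt (IZR N)).
Proof.
  intros hn HN [[p d] Hq].
  assert (Hpd : (p * p = N * (Z.pos d * Z.pos d))%Z).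
  { unfold Q2R in Hq; simpl in Hq.
    assert (HN0 : 0 <= IZR N) by (apply IZR_le; nia).
    assert (Hd : 0 < IZR (Z.pos d)) by (apply IZR_lt; lia).
    apply eq_IZR; rewrite !mult_IZR.
    rewrite <- (sqrt_sqrt _ HN0), Hq; field; lra. }
  assert (Hp : (0 <= p)%Z).
  { apply le_IZR. pose proof (sqrt_pos (IZR N)) as Hs; rewrite Hq in Hs.
    unfold Q2R in Hs; simpl in Hs.
    assert (Hd : 0 < / IZR (Z.pos d))
      by (apply Rinv_0_lt_compat, IZR_lt; lia).
    nra. }
  assert (Hd : (1 <= Z.pos d)%Z) by lia.
  clear Hq; revert p Hp Hd Hpd; generalize (Z.pos d) as q; clear d.
  (* Descent: if [p / q] is a square root of [N], so is
     [(N q - n p) / (p - n q)], with a smaller positive denominator. *)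
  intros q p Hp Hq; revert p Hp.
  pattern q; revert q Hq.
  apply (Zlt_lower_bound_ind _ 1%Z); intros q IH Hq p Hp Hpq.
  assert (H1 : (n * q < p)%Z) by nia.
  assert (H2 : (p < (n + 1) * q)%Z) by nia.
  apply (IH (p - n * q)%Z) with (p := (N * q - n * p)%Z); nia.
Qed.

Lemma irrational_neq_IZR (x : R) (k : Z) : irrational x -> x <> IZR k.
Proof.
  intros Hx E; apply Hx; exists (inject_Z k); rewrite E.
  unfold Q2R; simpl; field.
Qed.

Lemma irrational_inv_sub_IZR (x : R) (k : Z) :
  irrational x -> irrational (/ (x - IZR k)).
Proof.
  intros Hx [q Hq]; apply Hx; exists (inject_Z k + / q)%Q.
  pose proof (irrational_neq_IZR x k Hx) as Hk.
  assert (Hne : / (x - IZR k) <> 0) by (apply Rinv_neq_0_compat; lra).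
  rewrite Q2R_plus, Q2R_inv.
  - rewrite <- Hq, Rinv_inv. unfold Q2R; simpl; field.
  - intros E; apply Hne; rewrite Hq, (Qeq_eqR _ _ E). unfold Q2R; simpl; field.
Qed.

(** * Bounds on convergents and uniqueness of the expansion *)

Lemma convergent_ge_head (m : nat) : forall a : nat -> Z,
  (forall i, (1 <= i)%nat -> (0 < a i)%Z) -> IZR (a O) <= convergent a m.
Proof.
  induction m as [|m IH]; intros a Ha; simpl; [lra|].
  assert (H : IZR (a 1%nat) <= convergent (fun i => a (S i)) m)
    by (apply (IH (fun i => a (S i))); intros; apply Ha; lia).
  assert (H1 : 1 <= IZR (a 1%nat)) by (apply IZR_le; specialize (Ha 1%nat); lia).
  assert (0 < 1 / convergent (fun i => a (S i)) m)
    by (apply Rdiv_lt_0_compat; lra).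
  lra.
Qed.

Lemma convergent_shift_ge1 (a : nat -> Z) (m : nat) :
  (forall i, (1 <= i)%nat -> (0 < a i)%Z) ->
  1 <= convergent (fun i => a (S i)) m.
Proof.
  intros Ha; apply Rle_trans with (IZR (a 1%nat)).
  - apply IZR_le; specialize (Ha 1%nat); lia.
  - apply (convergent_ge_head m (fun i => a (S i))); intros; apply Ha; lia.
Qed.

Lemma cf_converges_bounds (x : R) (a : nat -> Z) :
  cf_converges x a -> IZR (a O) <= x <= IZR (a O) + 1.
Proof.
  intros [Ha Hl].
  assert (B : forall m, IZR (a O) <= convergent a m <= IZR (a O) + 1).
  { intros m; split; [now apply convergent_ge_head|].
    destruct m as [|m]; simpl; [lra|].
    pose proof (convergent_shift_ge1 a m Ha) as H.
    apply Rplus_le_compat_l. unfold Rdiv; rewrite Rmult_1_l, <- Rinv_1.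
    apply Rinv_le_contravar; lra. }
  split.
  - apply (is_lim_seq_le (fun _ => IZR (a O)) (convergent a) (IZR (a O)) x);
      [apply B | apply is_lim_seq_const | exact Hl].
  - apply (is_lim_seq_le (convergent a) (fun _ => IZR (a O) + 1) x (IZR (a O) + 1));
      [apply B | exact Hl | apply is_lim_seq_const].
Qed.

(** The convergents of the shifted sequence are [/ (convergent a (S m) - IZR (a O))], and inversion
    is continuous away from [0]. *)
Lemma cf_converges_shift (x : R) (a : nat -> Z) :
  x <> IZR (a O) -> cf_converges x a ->
  cf_converges (/ (x - IZR (a O))) (fun i => a (S i)).
Proof.
  intros Hx [Ha Hl]; split; [intros; apply Ha; lia|].
  apply is_lim_seq_ext with (fun m => / (convergent a (S m) - IZR (a O))).
  - intros m; simpl. pose proof (convergent_shift_ge1 a m Ha).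
    field; lra.
  - apply (is_lim_seq_inv _ (Finite (x - IZR (a O)))).
    + apply is_lim_seq_minus'; [|apply is_lim_seq_const].
      now apply is_lim_seq_incr_1 in Hl.
    + intros E; injection E; lra.
Qed.

Lemma cf_converges_unique (x : R) (a b : nat -> Z) :
  irrational x -> cf_converges x a -> cf_converges x b -> a = b.
Proof.
  intros Hx Ha Hb; apply functional_extensionality; intros i.
  revert x a b Hx Ha Hb; induction i as [|i IH]; intros x a b Hx Ha Hb.
  all: assert (E : a O = b O).
  (* Irrationality makes the lower bounds strict: [a O < x <= b O + 1] and [b O < x <= a O + 1],
     which forces equal integers. *)
  1,3: pose proof (cf_converges_bounds _ _ Ha);
       pose proof (cf_converges_bounds _ _ Hb);
       pose proof (irrational_neq_IZR x (a O) Hx);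
       pose proof (irrational_neq_IZR x (b O) Hx);
       assert (IZR (a O) < IZR (b O + 1)) by (rewrite plus_IZR; lra);
       assert (IZR (b O) < IZR (a O + 1)) by (rewrite plus_IZR; lra);
       assert (a O < b O + 1)%Z by (now apply lt_IZR);
       assert (b O < a O + 1)%Z by (now apply lt_IZR); lia.
  - exact E.
  - apply (IH (/ (x - IZR (a O))) (fun k => a (S k)) (fun k => b (S k))).
    + now apply irrational_inv_sub_IZR.
    + apply cf_converges_shift; [now apply irrational_neq_IZR | exact Ha].
    + rewrite E; apply cf_converges_shift;
        [now apply irrational_neq_IZR | exact Hb].
Qed.

(** * Convergence from a sequence of positive complete quotients *)

Lemma convergent_error (a : nat -> Z) (X : nat -> R) (m : nat) :
  (forall i, (1 <= i)%nat -> (0 < a i)%Z) ->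
  (forall i, X i = IZR (a i) + 1 / X (S i)) ->
  (forall i, 0 < X (S i)) ->
  Rabs (X O - convergent a m) <= 2 * (1 / 2) ^ m.
Proof.
  revert a X.
  (* Positivity improves to [1 <= X (S i)], since each such quotient is a positive integer plus a
     positive reciprocal. *)
  assert (Hge1 : forall (a : nat -> Z) (X : nat -> R),
    (forall i, (1 <= i)%nat -> (0 < a i)%Z) ->
    (forall i, X i = IZR (a i) + 1 / X (S i)) ->
    (forall i, 0 < X (S i)) -> forall i, 1 <= X (S i)).
  { intros a X Ha HX Hp i. rewrite HX.
    assert (1 <= IZR (a (S i))) by (apply IZR_le; specialize (Ha (S i)); lia).
    assert (0 < 1 / X (S (S i))) by (apply Rdiv_lt_0_compat; [lra | apply Hp]).
    lra. }
  assert (Hinv : forall y, 1 <= y -> 0 < 1 / y <= 1).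
  { intros y Hy; split; [apply Rdiv_lt_0_compat; lra|].
    unfold Rdiv; rewrite Rmult_1_l, <- Rinv_1; apply Rinv_le_contravar; lra. }
  (* The induction goes back two indices, hence two base cases. The constant [2] makes the bound
     equal to [1] at [m = 1], where the error is a difference of two numbers in (0, 1]. *)
  induction m as [[|[|m]] IH] using lt_wf_ind; intros a X Ha HX Hp;
    pose proof (Hge1 a X Ha HX Hp) as H1.
  - simpl. rewrite (HX O). pose proof (Hinv _ (H1 O)).
    apply Rabs_le; lra.
  - simpl. rewrite (HX O). pose proof (Hinv _ (H1 O)).
    assert (Ha1 : 1 <= IZR (a 1%nat)) by (apply IZR_le; specialize (Ha 1%nat); lia).
    pose proof (Hinv _ Ha1). apply Rabs_le; lra.
  - assert (Ha' : forall i, (1 <= i)%nat -> (0 < a (S i))%Z) by (intros; apply Ha; lia).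
    assert (D := IH m ltac:(lia) (fun i => a (S (S i))) (fun i => X (S (S i)))
      ltac:(intros; apply Ha; lia) ltac:(intros; apply HX) ltac:(intros; apply Hp)).
    pose proof (convergent_shift_ge1 (fun i => a (S i)) m Ha') as Hc.
    assert (Ha1 : 1 <= IZR (a 1%nat)) by (apply IZR_le; specialize (Ha 1%nat); lia).
    pose proof (H1 1%nat) as H2.
    rewrite (HX O), (HX 1%nat). simpl convergent. simpl in D.
    set (c := convergent (fun i => a (S (S i))) m) in *.
    set (y := X 2%nat) in *. set (b := IZR (a 1%nat)) in *.
    assert (Hy : 2 <= b * y + 1) by nra.
    assert (Hbc : 2 <= b * c + 1) by nra.
    (* Two steps scale the difference [y - c] by the inverse of a product of two factors, each at
       least [2]; the resulting [/ 4] matches [(1 / 2) ^ 2]. *)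
    replace (IZR (a O) + 1 / (b + 1 / y) - (IZR (a O) + 1 / (b + 1 / c)))
      with ((y - c) * / ((b * y + 1) * (b * c + 1)))
      by (field; repeat split; lra).
    assert (Hk : 0 < / ((b * y + 1) * (b * c + 1)) <= / 4).
    { split; [apply Rinv_0_lt_compat; nra | apply Rinv_le_contravar; nra]. }
    rewrite Rabs_mult, (Rabs_pos_eq (/ _)) by lra.
    simpl pow. pose proof (Rabs_pos (y - c)). nra.
Qed.

Lemma cf_converges_complete_quotients (a : nat -> Z) (X : nat -> R) :
  (forall i, (1 <= i)%nat -> (0 < a i)%Z) ->
  (forall i, X i = IZR (a i) + 1 / X (S i)) ->
  (forall i, 0 < X (S i)) ->
  cf_converges (X O) a.
Proof.
  intros Ha HX Hp; split; [exact Ha|].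
  assert (L : is_lim_seq (fun m => 2 * (1 / 2) ^ m) 0).
  { replace (Finite 0) with (Rbar_mult 2 0) by (simpl; f_equal; ring).
    apply is_lim_seq_scal_l, is_lim_seq_geom.
    rewrite Rabs_pos_eq; lra. }
  apply is_lim_seq_le_le with
    (u := fun m => X O - 2 * (1 / 2) ^ m) (w := fun m => X O + 2 * (1 / 2) ^ m).
  - intros m. pose proof (convergent_error a X m Ha HX Hp) as E.
    apply Rabs_le_between in E; lra.
  - replace (Finite (X O)) with (Finite (X O - 0)) by (f_equal; ring).
    apply is_lim_seq_minus'; [apply is_lim_seq_const | exact L].
  - replace (Finite (X O)) with (Finite (X O + 0)) by (f_equal; ring).
    apply is_lim_seq_plus'; [apply is_lim_seq_const | exact L].
Qed.

(** * Periodic sequences: convergence and minimality of the period *)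

Lemma periodic_seq_tail (a0 : Z) (block : list Z) (k : nat) :
  periodic_seq [a0] block (S k) = nth (k mod length block) block 0%Z.
Proof. unfold periodic_seq; simpl; now rewrite Nat.sub_0_r. Qed.

(** Reduces convergence to finitely many identities: [xs] lists the complete quotients of one
    period, and the index [S r mod length block] closes the cycle. *)
Lemma cf_converges_periodic (a0 : Z) (block : list Z) (x : R) (xs : list R) :
  block <> nil ->
  (forall r, (r < length block)%nat -> (0 < nth r block 0)%Z) ->
  (forall r, (r < length block)%nat -> 0 < nth r xs 0) ->
  x = IZR a0 + 1 / nth 0 xs 0 ->
  (forall r, (r < length block)%nat ->
     nth r xs 0 = IZR (nth r block 0%Z) + 1 / nth (S r mod length block) xs 0) ->
  cf_converges x (periodic_seq [a0] block).
Proof.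
  intros Hb Hpos Hxs Hx Hrec.
  assert (Hl : length block <> O) by (destruct block; simpl; congruence).
  assert (Hm : forall k, (k mod length block < length block)%nat)
    by (intros; now apply Nat.mod_upper_bound).
  apply (cf_converges_complete_quotients _
    (fun i => match i with O => x | S k => nth (k mod length block) xs 0 end)).
  - intros [|k] Hk; [lia|]. rewrite periodic_seq_tail; auto.
  - intros [|k].
    + rewrite Nat.Div0.mod_0_l. exact Hx.
    + rewrite periodic_seq_tail, Hrec by auto. do 3 f_equal.
      change (S (k mod length block)) with (1 + k mod length block)%nat.
      now rewrite Nat.Div0.add_mod_idemp_r.
  - auto.
Qed.

(** If [l] were smaller than the block length, moving [l] places on from a last entry of [block]
    would reach its entry [pred l]. Both would be equal, although the last entry occurs only
    once. *)
Lemma repeating_block_length_ge (a0 : Z) (block : list Z) (l : nat) :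
  block <> nil ->
  (forall r, (S r < length block)%nat ->
     nth r block 0%Z <> nth (pred (length block)) block 0%Z) ->
  has_repeating_block (periodic_seq [a0] block) l -> (length block <= l)%nat.
Proof.
  intros Hb Hlast (pre & blk & Hne & Hl & Hper).
  assert (Hl0 : l <> O) by (destruct blk; simpl in *; congruence).
  assert (HL : length block <> O) by (destruct block; simpl; congruence).
  destruct (Nat.le_gt_cases (length block) l) as [|Hlt]; [assumption|exfalso].
  set (L := length block) in *; set (p := length pre) in *.
  apply (Hlast (pred l)); [lia|].
  (* Skipping [p] full blocks puts the chosen index past the preperiod [pre], whatever its
     length. *)
  assert (Hi : (p <= pred L + p * L)%nat) by nia.
  pose proof (Hper (S (pred L + p * L))) as E1.
  pose proof (Hper (S ((pred L + p * L) + l))) as E2.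
  rewrite periodic_seq_tail in E1, E2. fold L in E1, E2.
  rewrite Nat.Div0.mod_add, Nat.mod_small in E1 by lia.
  replace (pred L + p * L + l)%nat with (pred l + S p * L)%nat in E2 at 1 by lia.
  rewrite Nat.Div0.mod_add, Nat.mod_small in E2 by lia.
  rewrite E1, E2. unfold periodic_seq; fold p.
  destruct (Nat.ltb_spec (S (pred L + p * L + l)) p); [lia|].
  destruct (Nat.ltb_spec (S (pred L + p * L)) p); [lia|].
  rewrite Hl. f_equal.
  replace (S (pred L + p * L + l) - p)%nat
    with (S (pred L + p * L) - p + 1 * l)%nat by lia.
  apply Nat.Div0.mod_add.
Qed.

Lemma periodic_expansion (a0 : Z) (block : list Z) (x : R) :
  block <> nil ->
  (forall r, (S r < length block)%nat ->
     nth r block 0%Z <> nth (pred (length block)) block 0%Z) ->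
  irrational x -> cf_converges x (periodic_seq [a0] block) ->
  cf_period_length x (length block) /\ cf_expansion x (periodic_seq [a0] block).
Proof.
  intros Hb Hlast Hx Hc.
  assert (E : cf_expansion x (periodic_seq [a0] block)).
  { split; [exact Hx|split; [exact Hc|]].
    intros b; now apply cf_converges_unique. }
  split; [|exact E].
  exists (periodic_seq [a0] block); split; [exact E|split].
  - now exists [a0], block.
  - intros l; now apply repeating_block_length_ge.
Qed.

(** * The explicit complete quotients of the square root of [n ^ 2 + 4] *)

Lemma eq_plus_inv (x a y : R) : y <> 0 -> (x - a) * y = 1 -> x = a + 1 / y.
Proof. intros Hy E; rewrite <- E; field; exact Hy. Qed.

Theorem mainTheorem3 (n j N : Z)
  (hn : (1 <= n)%Z) (hj : j = 4%Z) (hjn : (j <= 2 * n)%Z)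
  (hN : N = (n ^ 2 + j)%Z) :
  (Z.Even n ->
     cf_period_length (sqrt (IZR N)) 2 /\
     cf_expansion (sqrt (IZR N))
       (periodic_seq [n] [(2 * n / j)%Z; (2 * n)%Z])) /\
  (Z.Odd n ->
     cf_period_length (sqrt (IZR N)) 5 /\
     cf_expansion (sqrt (IZR N))
       (periodic_seq [n]
          [((n - 1) / 2)%Z; 1%Z; 1%Z; ((n - 1) / 2)%Z; (2 * n)%Z])).
Proof.
  subst j.
  (* The bound [4 <= 2 * n] gives [n >= 2], hence [n ^ 2 + 4 < (n + 1) ^ 2]. *)
  assert (Hirr : irrational (sqrt (IZR N)))
    by (apply (sqrt_between_squares_irrational n); nia).
  assert (Hss : sqrt (IZR N) * sqrt (IZR N) = IZR n * IZR n + 4).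
  { rewrite sqrt_sqrt by (apply IZR_le; nia).
    rewrite hN, plus_IZR, Z.pow_2_r, mult_IZR; reflexivity. }
  pose proof (sqrt_pos (IZR N)) as Hs0.
  assert (Hn2 : 2 <= IZR n) by (apply IZR_le; lia).
  split.
  - intros [h Hh].
    assert (E : (2 * n / 4)%Z = h) by (symmetry; apply (Z.div_unique_exact _ 4); lia).
    rewrite E.
    apply (periodic_expansion n [h; (2 * n)%Z]); [discriminate| |exact Hirr|].
    { intros [|r] Hr; cbn [length nth pred] in *; lia. }
    set (s := sqrt (IZR N)) in *.
    assert (Hhn : IZR n = 2 * IZR h) by (rewrite Hh, mult_IZR; reflexivity).
    apply cf_converges_periodic with (xs := [(s + IZR n) / 4; s + IZR n]).
    + discriminate.
    + intros [|[|r]] Hr; cbn [length nth pred] in *; lia.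
    + intros [|[|r]] Hr; simpl in *; try lia; lra.
    (* With denominators cleared, this is [(s - n) * (s + n) = 4]. *)
    + apply eq_plus_inv; simpl; nra.
    + intros [|[|r]] Hr; cbn -[Z.mul IZR] in Hr |- *; try lia;
        apply eq_plus_inv; try rewrite mult_IZR; nra.
  - intros [h Hh].
    assert (E : ((n - 1) / 2)%Z = h) by (symmetry; apply (Z.div_unique_exact _ 2); lia).
    rewrite E.
    apply (periodic_expansion n [h; 1%Z; 1%Z; h; (2 * n)%Z]);
      [discriminate| |exact Hirr|].
    { intros [|[|[|[|r]]]] Hr; cbn [length nth pred] in *; lia. }
    set (s := sqrt (IZR N)) in *.
    assert (Hhn : IZR h = (IZR n - 1) / 2)
      by (rewrite Hh, plus_IZR, mult_IZR; field).
    assert (Hq : forall t, 0 < t -> 0 < t / IZR n)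
      by (intros; apply Rdiv_lt_0_compat; lra).
    assert (Hq2 := Hq (s + IZR n - 2) ltac:(nra)).
    assert (Hq3 := Hq (s + 2) ltac:(lra)).
    apply cf_converges_periodic with
      (xs := [(s + IZR n) / 4; (s + IZR n - 2) / IZR n; (s + 2) / IZR n;
              (s + IZR n - 2) / 4; s + IZR n]).
    + discriminate.
    (* An odd [n >= 2] is at least [3], so [h] is positive. *)
    + intros [|[|[|[|[|r]]]]] Hr; cbn [length nth pred] in *; lia.
    + intros [|[|[|[|[|r]]]]] Hr; simpl in *; try lia; nra.
    + apply eq_plus_inv; simpl; nra.
    (* Each product is a difference of squares: [s^2 - (n-2)^2 = 4n] for the first and third
       quotients, [s^2 - 4 = n^2] for the second, [s^2 - n^2 = 4] for the last two. *)
    + intros [|[|[|[|[|r]]]]] Hr; cbn -[Z.mul IZR] in Hr |- *; try lia;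
        apply eq_plus_inv; try rewrite mult_IZR; try rewrite Hhn; try nra;
        field_simplify_eq; try lra; ring [Hss].
Qed.
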